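(* Let $1\le\kappa<+\infty$ and suppose that $\pi$ satisfies the margin assumption (MA1)$(\kappa)$ with constant $c>0$, that is, $\mathbb{E}\{|f(X)-f^*(X)|\}\le c\,(R(f)-R^* )^{1/\kappa}$ for all measurable $f:\mathcal{X}\to\{-1,1\}$. Let $n\ge 1$ and $M\ge 2$ be integers, and assume there are two positive numbers $a\ge 1$, $b$ such that $M\ge a n^b$. Let $f_1,\dots,f_M:\mathcal{X}\to\{-1,1\}$ be prediction rules. Let $\tilde f_n=\sum_{j=1}^M w_jf_j$, where $w_1,\dots,w_M$ are $D_n$-measurable, $w_j\ge 0$ and $\sum_{j=1}^M w_j=1$, satisfy $$A_n(\tilde f_n)\le \min_{i=1,\dots,M}A_n(f_i)+\frac{\log M}{n}$$ (for instance, $\tilde f_n$ may be the AEW procedure or the ERM procedure). Then $$\mathbb{E}[R(\tilde f_n)-R^*]\le\left(1+\frac{2}{\log^{1/4}(M)}\right)\left\{2\min_{j=1,\dots,M}(R(f_j)-R^* )+C_0\frac{\log^{7/4}(M)}{n^{\kappa/(2\kappa-1)}}\right\},$$ where $C_0>0$ is a constant depending only on $a,b,c$; for instance one can take $C_0=10+c\,a^{-1/(2b)}+a^{-1/b}\exp\left[(b(8c/6)^2)\vee(((8c/3)\vee 1)/b)^2\right]$.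
   Context: $(\mathcal{X},\mathcal{A})$ is a measurable space, $\pi$ is a probability distribution on $\mathcal{X}\times\{-1,1\}$, $D_n=((X_i,Y_i))_{i=1,\dots,n}$ is an i.i.d. sample from $\pi$, and $(X,Y)\sim\pi$ is independent of $D_n$. A prediction rule is a measurable function $f:\mathcal{X}\to\{-1,1\}$; its misclassification error is $R(f)=\mathbb{P}(Y\ne f(X))$. Let $\eta(x)=\mathbb{P}(Y=1|X=x)$, $f^*(x)=\mathrm{sign}(2\eta(x)-1)$ (Bayes rule, with $\mathrm{sign}(0)=1$) and $R^*=R(f^* )=\min_f R(f)$. For a real-valued, possibly data-dependent, function $f$, $R(f)$ denotes $\mathbb{P}(Y\ne\mathrm{sign}(f(X))\mid D_n)$. The empirical hinge risk is $A_n(f)=\frac1n\sum_{i=1}^n(1-Y_if(X_i))_+$, with $z_+=\max(0,z)$, and the empirical risk is $R_n(f)=\frac1n\sum_{i=1}^n \mathbb{1}_{(Y_if(X_i)\le 0)}$. The AEW procedure is $\sum_{j=1}^M w_j^{(n)}f_j$ with $w_j^{(n)}=\exp(-nA_n(f_j))/\sum_{k=1}^M\exp(-nA_n(f_k))$; the ERM procedure is any element of $\{f_1,\dots,f_M\}$ minimizing $R_n$. $x\vee y=\max(x,y)$. *)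

(* Defs.v *)
From HB Require Import structures.
From mathcomp Require Export all_boot all_order all_algebra.
From mathcomp Require Export all_classical all_reals all_analysis.

Set Implicit Arguments.
Unset Strict Implicit.
Unset Printing Implicit Defensive.

Import Order.TTheory GRing.Theory Num.Theory.
Import numFieldNormedType.Exports.

Local Open Scope classical_set_scope.
Local Open Scope ring_scope.

(** The label space {-1, 1} is encoded by [bool] (with its discrete
    sigma-algebra): [true] is the label 1 and [false] is the label -1. *)

Definition lab (R : realType) (y : bool) : R := if y then 1 else -1.

(** [sign 0 = 1]. *)
Definition sgn (R : realType) (z : R) : bool := 0 <= z.

Section Population.
Context (R : realType) (d : measure_display) (X : measurableType d).
Variable Pi : probability (X * bool)%type R.

Definition risk (f : X -> bool) : R := fine (Pi [set z | z.2 != f z.1]).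

(** Risk of a real-valued function.  When [h] depends on a sample [D_n], this
    is P(Y <> sign(h(X)) | D_n) for a pair (X, Y) of law [Pi] independent of
    [D_n]. *)
Definition risk_real (h : X -> R) : R := risk (fun x => sgn (h x)).

(** [eta] is a version of x |-> P(Y = 1 | X = x). *)
Definition is_regression (eta : X -> R) : Prop :=
  [/\ measurable_fun setT eta,
      Pi.-integrable setT (fun z => (eta z.1)%:E) &
      forall A : set X, measurable A ->
        (\int[Pi]_(z in A `*` setT) (eta z.1)%:E)%E = Pi (A `*` [set true])].

Definition bayes (eta : X -> R) (x : X) : bool := sgn (2 * eta x - 1).

Definition margin_assumption (eta : X -> R) (kappa c : R) : Prop :=
  forall f : X -> bool, measurable_fun setT f ->
    ('E_Pi[fun z => (`|lab R (f z.1) - lab R (bayes eta z.1)|)%R]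
       <= (c * (risk f - risk (bayes eta)) `^ kappa^-1)%R%:E)%E.

End Population.

Section Sample.
Context (R : realType) (d d' : measure_display).
Context (X : measurableType d) (Omega : measurableType d').
Variable n : nat.
Variable Z : 'I_n -> Omega -> (X * bool)%type.

Definition iid_sample (P : probability Omega R)
    (Pi : probability (X * bool)%type R) : Prop :=
  [/\ forall i, measurable_fun setT (Z i),
      forall i (A : set (X * bool)), measurable A -> P (Z i @^-1` A) = Pi A &
      forall (J : {set 'I_n}) (A : 'I_n -> set (X * bool)),
        (forall i, measurable (A i)) ->
        P (\bigcap_(i in [set i | i \in J]) (Z i @^-1` A i)) =
        (\prod_(i in J) P (Z i @^-1` A i))%E].

(** Measurability with respect to the sigma-algebra generated by the sample. *)
Definition sample_measurable (w : Omega -> R) : Prop :=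
  forall B : set R, measurable B -> g_sigma_preimage Z (w @^-1` B).

End Sample.

Section Empirical.
Context (R : realType) (X : Type) (n : nat).
Variable D : 'I_n -> (X * bool)%type.

Definition hinge_risk (h : X -> R) : R :=
  n%:R^-1 * \sum_(i < n) Num.max 0 (1 - lab R (D i).2 * h (D i).1).

Definition emp_risk (h : X -> R) : R :=
  n%:R^-1 * \sum_(i < n) (lab R (D i).2 * h (D i).1 <= 0)%R%:R.

End Empirical.

Definition rule_fun (R : realType) (X : Type) (f : X -> bool) (x : X) : R :=
  lab R (f x).

Definition aggregate (R : realType) (X : Type) (M : nat)
    (f : 'I_M -> X -> bool) (w : 'I_M -> R) (x : X) : R :=
  \sum_(j < M) w j * lab R (f j x).

(** For [M > 0] the range of [F] is finite and nonempty, so its infimum is the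
    minimum of the [F j]. *)
Definition minI (R : realType) (M : nat) (F : 'I_M -> R) : R := inf (range F).

Definition admissible_weights (R : realType) (d d' : measure_display)
    (X : measurableType d) (Omega : measurableType d') (n M : nat)
    (Z : 'I_n -> Omega -> (X * bool)%type) (f : 'I_M -> X -> bool)
    (w : 'I_M -> Omega -> R) : Prop :=
  [/\ forall j, sample_measurable Z (w j),
      forall j omega, 0 <= w j omega,
      forall omega, \sum_(j < M) w j omega = 1 &
      forall omega,
        hinge_risk (Z^~ omega) (aggregate f (w^~ omega)) <=
        minI (fun j => hinge_risk (Z^~ omega) (rule_fun R (f j)))
          + ln M%:R / n%:R].

Definition aew_weight (R : realType) (X Omega : Type) (n M : nat)
    (Z : 'I_n -> Omega -> (X * bool)%type) (f : 'I_M -> X -> bool)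
    (j : 'I_M) (omega : Omega) : R :=
  let A k := hinge_risk (Z^~ omega) (rule_fun R (f k)) in
  expR (- (n%:R * A j)) / \sum_(k < M) expR (- (n%:R * A k)).

(** An ERM procedure, as a sample-measurable choice of the index of a minimizer
    of the empirical risk. *)
Definition is_erm (R : realType) (d d' : measure_display)
    (X : measurableType d) (Omega : measurableType d') (n M : nat)
    (Z : 'I_n -> Omega -> (X * bool)%type) (f : 'I_M -> X -> bool)
    (jhat : Omega -> 'I_M) : Prop :=
  (forall j, g_sigma_preimage Z [set omega | jhat omega = j]) /\
  (forall omega k, emp_risk (Z^~ omega) (rule_fun R (f (jhat omega))) <=
                   emp_risk (Z^~ omega) (rule_fun R (f k))).

Definition erm_weight (R : realType) (Omega : Type) (M : nat)
    (jhat : Omega -> 'I_M) (j : 'I_M) (omega : Omega) : R :=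
  (j == jhat omega)%:R.

Definition C0 (R : realType) (a b c : R) : R :=
  10 + c * a `^ (- (1 / (2 * b)))
     + a `^ (- (1 / b)) *
         expR (Num.max (b * (8 * c / 6) ^+ 2) ((Num.max (8 * c / 3) 1 / b) ^+ 2)).

(* Main.v *)
(** Write L = ln M, N = n^(kappa/(2 kappa - 1)) and u_j for the excess risk of
    f_j.  The sign of the aggregate is a weighted majority vote, so its excess
    risk is at most G = 2 sum_j w_j u_j; the empirical hinge risk is affine on
    convex combinations of rules, so the hypothesis on the weights bounds
    (1 - gam) G by the largest deviation (1 - gam) u_j - (R_n(f_j) - R_n(f* ))
    plus empirical terms of a single rule f_j0.  An exponential moment of scale
    s controls the maximum of the deviations without any measurability of w:
    the margin assumption bounds the second moments by (c/2) u_j^(1/kappa), and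
    the choices gam = L^(-1/4)/2, s = L^(-3/4) N/n balance the terms, using
    N/n * u^(1/kappa) <= u + 1/N.  This needs L >= 1 and 2c <= sqrt L; when one
    of these fails, C0 >= N and the bound exceeds 1. *)

Require Import Defs.
From HB Require Import structures.
From mathcomp Require Import all_boot all_order all_algebra.
From mathcomp Require Import all_classical all_reals all_analysis.
From mathcomp Require Import measurable_realfun.
From mathcomp Require Import ring lra.
Import Order.TTheory GRing.Theory Num.Theory.
Import numFieldNormedType.Exports.
Local Open Scope classical_set_scope.
Local Open Scope ring_scope.

Set Implicit Arguments.
Unset Strict Implicit.
Unset Printing Implicit Defensive.

(** * Means and independent samples *)

Section HasMean.
Import HBNNSimple.
Context (R : realType) (d : measure_display) (T : measurableType d).
Variable P : probability T R.
Implicit Types f g : T -> R.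

(** Integrability and value travel together, so that means can be handled as real numbers without
    side conditions in the extended reals. *)
Definition has_mean (f : T -> R) (v : R) : Prop :=
  P.-integrable setT (fun x => (f x)%:E) /\ (\int[P]_x (f x)%:E)%E = v%:E.

Lemma has_mean_unique f u v : has_mean f u -> has_mean f v -> u = v.
Proof. by move=> [_ fu] [_]; rewrite fu => -[]. Qed.

Lemma eq_has_mean f g v : f =1 g -> has_mean f v -> has_mean g v.
Proof. by move=> /funext ->. Qed.

Lemma has_mean_cst k : has_mean (fun=> k) k.
Proof.
split; last by have := expectation_cst P k; rewrite unlock.
apply: (@measurable_bounded_integrable _ _ _ P (cst k) setT) => //.
  by rewrite -ge0_fin_numE ?fin_num_measure.
by exists `|k|; split; [exact: num_real|move=> x /ltW kx y _; exact: kx].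
Qed.

Lemma has_mean_indic (A : set T) : measurable A ->
  has_mean (\1_A) (fine (P A)).
Proof.
move=> mA; split; first exact: integrable_indic.
by rewrite integral_indic// setIT fineK// fin_num_measure.
Qed.

Lemma has_meanD f g u v : has_mean f u -> has_mean g v ->
  has_mean (fun x => f x + g x) (u + v).
Proof.
move=> [fi fu] [gi gv]; split; first by have := integrableD measurableT fi gi.
by rewrite integralD_EFin// fu gv.
Qed.

Lemma has_meanZ k f u : has_mean f u -> has_mean (fun x => k * f x) (k * u).
Proof.
move=> [fi fu]; split; first by have := integrableZl measurableT k fi.
under eq_integral do rewrite EFinM.
by rewrite integralZl// fu.
Qed.

Lemma has_meanN f u : has_mean f u -> has_mean (fun x => - f x) (- u).
Proof.
move=> /(has_meanZ (-1)); rewrite mulN1r; apply: eq_has_mean => x.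
by rewrite mulN1r.
Qed.

Lemma has_meanB f g u v : has_mean f u -> has_mean g v ->
  has_mean (fun x => f x - g x) (u - v).
Proof. by move=> fu gv; exact: has_meanD fu (has_meanN gv). Qed.

Lemma has_mean_sum (I : finType) (f : I -> T -> R) (v : I -> R) :
  (forall i, has_mean (f i) (v i)) ->
  has_mean (fun x => \sum_i f i x) (\sum_i v i).
Proof.
move=> fv; elim: (index_enum I) => [|i s IH].
  rewrite big_nil; apply: eq_has_mean (has_mean_cst 0) => x.
  by rewrite big_nil.
rewrite big_cons; apply: eq_has_mean (has_meanD (fv i) IH) => x.
by rewrite big_cons.
Qed.

Lemma le_has_mean f g u v : has_mean f u -> has_mean g v ->
  (forall x, f x <= g x) -> u <= v.
Proof.
move=> [fi fu] [gi gv] fg; rewrite -lee_fin -fu -gv.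
by apply: le_integral => // x _; rewrite lee_fin.
Qed.

(* [f] need not be measurable: for nonnegative functions the integral is a
   supremum over simple functions, hence monotone. *)
Lemma expectation_le_mean f g v : has_mean g v ->
  (forall x, 0 <= f x <= g x) -> ('E_P[f] <= v%:E)%E.
Proof.
move=> [gi gv] fg; rewrite unlock -gv.
have f0 x : (0 <= (f x)%:E)%E by rewrite lee_fin; case/andP: (fg x).
have g0 x : (0 <= (g x)%:E)%E.
  by rewrite lee_fin; case/andP: (fg x) => /le_trans; apply.
rewrite !ge0_integralTE//; apply: ereal_sup_le => _ [h /= hf <-].
exists h => // x.
by rewrite (le_trans (hf x))// lee_fin; case/andP: (fg x).
Qed.

(** Measurability of the fibres, with no sigma-algebra on the finite type. Factoring integrands
    through such maps turns integrals into finite sums. *)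
Definition finitely_measurable (K : finType) (t : T -> K) : Prop :=
  forall k, measurable (t @^-1` [set k]).

Lemma has_mean_fin (K : finType) (t : T -> K) (g : K -> R) :
  finitely_measurable t ->
  has_mean (g \o t) (\sum_k g k * fine (P (t @^-1` [set k]))).
Proof.
move=> mt; have := has_mean_sum (fun k => has_meanZ (g k) (has_mean_indic (mt k))).
apply: eq_has_mean => x; rewrite (bigD1 (t x))//= big1 ?addr0 => [|k kx].
  by rewrite indicE mem_set// mulr1.
by rewrite indicE memNset ?mulr0//= => txk; rewrite -txk eqxx in kx.
Qed.

End HasMean.

(** * Closure properties of measurable maps into finite types *)

Section FinitelyMeasurable.
Context (d : measure_display) (T : measurableType d).

Lemma finitely_measurable_bool (e : T -> bool) :
  measurable_fun setT e -> finitely_measurable e.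
Proof. by move=> me k; rewrite -[X in measurable X]setTI; exact: me. Qed.

Lemma finitely_measurable_pair (K K' : finType) (t : T -> K) (t' : T -> K') :
  finitely_measurable t -> finitely_measurable t' ->
  finitely_measurable (fun x => (t x, t' x)).
Proof.
move=> mt mt' [k k']; have := measurableI _ _ (mt k) (mt' k').
by congr measurable; apply/seteqP; split=> x /= [-> ->].
Qed.

Lemma finitely_measurable_ffun (K I : finType) (t : I -> T -> K) :
  (forall i, finitely_measurable (t i)) ->
  finitely_measurable (fun x => [ffun i => t i x]).
Proof.
move=> mt k.
have -> : (fun x => [ffun i => t i x]) @^-1` [set k] =
    \bigcap_(i in [set: I]) (t i @^-1` [set k i]).
  apply/seteqP; split=> x /=; first by move=> <- i _; rewrite /= ffunE.
  by move=> tk; apply/ffunP => i; rewrite ffunE; exact: tk.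
by apply: fin_bigcap_measurable => // i _; exact: mt.
Qed.

End FinitelyMeasurable.

Section FiniteComposition.
Context (d d' : measure_display).
Context (T : measurableType d) (T' : measurableType d').

Lemma finitely_measurable_post (K K' : finType) (t : T -> K) (h : K -> K') :
  finitely_measurable t -> finitely_measurable (h \o t).
Proof.
move=> mt k'.
have -> : (h \o t) @^-1` [set k'] =
    \bigcup_(k in [set k | h k = k']) (t @^-1` [set k]).
  by apply/seteqP; split=> x /=; [exists (t x)|move=> [k /= <- ->]].
by apply: fin_bigcup_measurable => // k _; exact: mt.
Qed.

Lemma finitely_measurable_pre (K : finType) (t : T' -> K) (h : T -> T') :
  measurable_fun setT h -> finitely_measurable t ->
  finitely_measurable (t \o h).
Proof.
by move=> mh mt k; rewrite comp_preimage -[X in measurable X]setTI; exact: mh.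
Qed.

End FiniteComposition.

(** * Means over an independent sample *)

Section IidMeans.
Context (R : realType) (d d' : measure_display).
Context (X : measurableType d) (Omega : measurableType d').
Variables (P : probability Omega R) (Pi : probability (X * bool)%type R).
Variables (n : nat) (Z : 'I_n -> Omega -> (X * bool)%type).
Hypothesis hZ : iid_sample Z P Pi.
Variables (K : finType) (t : X * bool -> K) (g : K -> R) (m : R).
Hypothesis mt : finitely_measurable t.
Hypothesis gm : has_mean Pi (g \o t) m.

(** Both means are the same finite sum over the values of [t], because corresponding fibres have
    equal probability. *)
Lemma has_mean_sample (i : 'I_n) : has_mean P (fun om => g (t (Z i om))) m.
Proof.
case: hZ => mZ idZ _; rewrite (has_mean_unique gm (has_mean_fin Pi g mt)).
under eq_bigr do rewrite -(idZ i)//.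
exact: (has_mean_fin P g (finitely_measurable_pre (mZ i) mt)).
Qed.

(** Independence is given for events. The power of the finite sum is distributed over all vectors of
    values; each term is the weighted probability of a joint fibre, which factorizes. *)
Lemma has_mean_prod_sample :
  has_mean P (fun om => \prod_i g (t (Z i om))) (m ^+ n).
Proof.
case: hZ => mZ idZ indZ; rewrite (has_mean_unique gm (has_mean_fin Pi g mt)).
have mtZ : finitely_measurable (fun om => [ffun i => t (Z i om)]).
  by apply: finitely_measurable_ffun => i; exact: finitely_measurable_pre.
have := has_mean_fin P (fun phi : {ffun 'I_n -> K} => \prod_i g (phi i)) mtZ.
rewrite -[X in _ ^+ X]card_ord -prodr_const bigA_distr_bigA/=.
set u := (X in has_mean _ _ X); set v := (X in _ -> has_mean _ _ X).
have <- : u = v.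
  apply: eq_bigr => phi _; rewrite big_split/=; congr (_ * _).
  have -> : (fun om => [ffun i => t (Z i om)]) @^-1` [set phi] =
      \bigcap_(i in [set i | i \in [set: 'I_n]%SET])
        (Z i @^-1` (t @^-1` [set phi i])).
    apply/seteqP; split=> om /=; first by move=> <- i _; rewrite /= ffunE.
    by move=> tphi; apply/ffunP => i; rewrite ffunE; apply: tphi; rewrite /= inE.
  rewrite indZ// -[RHS]/(fine (\prod_i fine (Pi (t @^-1` [set phi i])))%:E).
  rewrite -prodEFin; congr fine; apply: eq_big => [i|i _]; first by rewrite inE.
  by rewrite idZ// fineK// fin_num_measure.
by apply: eq_has_mean => om; apply: eq_bigr => i _; rewrite ffunE.
Qed.

End IidMeans.

(** * Excess risk and the Bayes rule *)

Section Excess.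
Context (R : realType) (d : measure_display) (X : measurableType d).
Variables (Pi : probability (X * bool)%type R) (eta : X -> R).
Hypothesis heta : is_regression Pi eta.
Implicit Types g : X -> bool.
Local Notation bay := (bayes eta).
Local Notation excess g := (risk Pi g - risk Pi bay).

Lemma measurable_bayes : measurable_fun setT bay.
Proof.
case: heta => meta _ _; rewrite /bayes /sgn.
apply: measurable_fun_ler => //; apply: measurable_funB => //.
exact: measurable_funM.
Qed.

Lemma finitely_measurable_fst g : measurable_fun setT g ->
  finitely_measurable (fun z : X * bool => g z.1).
Proof.
by move=> mg; apply: finitely_measurable_bool; exact: measurableT_comp.
Qed.

Lemma finitely_measurable_err g : measurable_fun setT g ->
  finitely_measurable (fun z : X * bool => z.2 != g z.1).
Proof.
move=> mg; have mg1 := finitely_measurable_fst mg.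
have m2 : finitely_measurable (@snd X bool).
  by apply: finitely_measurable_bool; exact: measurable_snd.
exact: (finitely_measurable_post (fun p : bool * bool => p.1 != p.2)
  (finitely_measurable_pair m2 mg1)).
Qed.

Lemma has_mean_true d' (T : measurableType d') (P : probability T R)
    (e : T -> bool) : finitely_measurable e ->
  has_mean P (fun z => (e z)%:R) (fine (P [set z | e z])).
Proof.
move=> /(_ true) me; have -> : [set z | e z] = e @^-1` [set true] by [].
apply: eq_has_mean (has_mean_indic P me) => z.
by rewrite indicE; congr (nat_of_bool _)%:R; apply/idP/idP; rewrite inE.
Qed.

Lemma has_mean_err g : measurable_fun setT g ->
  has_mean Pi (fun z => (z.2 != g z.1)%:R) (risk Pi g).
Proof. by move=> mg; exact: (has_mean_true Pi (finitely_measurable_err mg)). Qed.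

(* On a rectangle [B * bool], replacing the label by its regression function
   2 eta - 1 does not change the mean. *)
Lemma label_mean (B : set X) (be : bool) : measurable B ->
  (forall x, B x -> bay x = be) ->
  exists2 v, 0 <= v &
    has_mean Pi (fun z => lab R be * lab R z.2 * \1_B z.1) v.
Proof.
move=> mB Bbe; case: heta => meta ieta Eeta.
have mBT : measurable (B `*` [set: bool]) by exact: measurableX.
have mBt : measurable (B `*` [set true]) by exact: measurableX.
(* The value comes from writing the label as twice the indicator of label 1, minus 1. Its sign is
   read off at the end, from the same number seen as the mean of the sign [be] times 2 eta - 1 on
   [B]. *)
exists (lab R be * (2 * fine (Pi (B `*` [set true])) -
                    fine (Pi (B `*` [set: bool])))); last first.
  have /(has_meanZ (lab R be)) := has_meanB
    (has_meanZ 2 (has_mean_indic Pi mBt)) (has_mean_indic Pi mBT).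
  apply: eq_has_mean => -[x y]; rewrite -mulrA; congr (_ * _).
  rewrite !indicE !in_setX/= in_setT andbT.
  have -> : (y \in [set true]) = y by case: y; [rewrite mem_set|rewrite memNset].
  by case: (x \in B); case: y; rewrite /= /lab; lra.
have etaB : has_mean Pi (fun z => eta z.1 * \1_(B `*` [set: bool]) z)
    (fine (Pi (B `*` [set true]))).
  split.
    have /(integrable_mkcond _ mBT).1 :=
      integrableS measurableT mBT (@subsetT _ _) ieta.
    apply: eq_integrable => // z _; rewrite patchE indicE.
    by case: ifP; rewrite ?mulr1 ?mulr0.
  rewrite fineK ?fin_num_measure// -Eeta// [RHS]integral_mkcond.
  apply: eq_integral => z _; rewrite patchE indicE.
  by case: ifP; rewrite ?mulr1 ?mulr0.
have /(has_meanZ (lab R be)) := has_meanB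
  (has_meanZ 2 etaB) (has_mean_indic Pi mBT).
move/(le_has_mean (has_mean_cst Pi 0)); apply=> -[x y].
rewrite indicE in_setX/= in_setT andbT.
case: (boolP (x \in B)) => [xB|_]; last by rewrite !mulr0 subr0 mulr0.
have := Bbe x (set_mem xB); rewrite /bayes /sgn /lab => <-.
by case: (leP 0 (2 * eta x - 1)) => /= ?; rewrite !mulr1; lra.
Qed.
End Excess.

Section ExcessRisk.
Context (R : realType) (d : measure_display) (X : measurableType d).
Variables (Pi : probability (X * bool)%type R) (eta : X -> R).
Hypothesis heta : is_regression Pi eta.
Implicit Types g : X -> bool.
Local Notation bay := (bayes eta).
Local Notation excess g := (risk Pi g - risk Pi bay).

(** The space is cut into the cells where [t] and the Bayes rule are constant; [label_mean] gives
    the sign on each cell. *)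
Lemma bayes_weight_mean_ge0 (K : finType) (t : X -> K) (q : K -> R) :
  finitely_measurable t -> (forall x, 0 <= q (t x)) ->
  exists2 v, 0 <= v &
    has_mean Pi (fun z => lab R (bay z.1) * lab R z.2 * q (t z.1)) v.
Proof.
move=> mt q0.
have mt' := finitely_measurable_pair mt
  (finitely_measurable_bool (measurable_bayes heta)).
pose B k := (fun x => (t x, bay x)) @^-1` [set k].
have /choice[v vP] : forall k : K * bool, exists v, 0 <= v /\
    has_mean Pi (fun z => lab R k.2 * lab R z.2 * \1_(B k) z.1) v.
  move=> k; have [|v ? ?] := label_mean heta (B := B k) (be := k.2) (mt' k).
    by move=> x <-.
  by exists v.
(* [q] is known to be nonnegative only at values taken by [t]; the absolute value makes every
   coefficient nonnegative and changes nothing on nonempty cells. *)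
exists (\sum_k `|q k.1| * v k).
  by apply: sumr_ge0 => k _; rewrite mulr_ge0//; case: (vP k).
have := has_mean_sum (fun k => has_meanZ `|q k.1| (vP k).2).
apply: eq_has_mean => -[x y] /=.
rewrite (bigD1 (t x, bay x))//= big1 ?addr0 => [|k kx].
  by rewrite indicE mem_set// mulr1 ger0_norm// mulrC.
by rewrite indicE memNset ?mulr0//= => txk; rewrite -txk eqxx in kx.
Qed.

(** The two losses differ only where [g] and the Bayes rule disagree; the difference is then 1 if
    the label follows the Bayes rule and -1 otherwise. *)
Lemma has_mean_excess g : measurable_fun setT g ->
  has_mean Pi (fun z => lab R (bay z.1) * lab R z.2 * (g z.1 != bay z.1)%:R)
    (excess g).
Proof.
move=> mg.
have := has_meanB (has_mean_err Pi mg) (has_mean_err Pi (measurable_bayes heta)).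
apply: eq_has_mean => -[x y] /=.
by case: (g x); case: (bay x); case: y; rewrite /lab /=; lra.
Qed.

Lemma finitely_measurable_neq_bayes g : measurable_fun setT g ->
  finitely_measurable (fun x => g x != bay x).
Proof.
move=> mg; exact: (finitely_measurable_post (fun p : bool * bool => p.1 != p.2)
  (finitely_measurable_pair (finitely_measurable_bool mg)
     (finitely_measurable_bool (measurable_bayes heta)))).
Qed.

Lemma excess_ge0 g : measurable_fun setT g -> 0 <= excess g.
Proof.
move=> mg; have [v v0 vE] := bayes_weight_mean_ge0
  (q := fun b : bool => b%:R) (finitely_measurable_neq_bayes mg)
  (fun x => ler0n _ _).
by rewrite (has_mean_unique (has_mean_excess mg) vE).
Qed.

Lemma risk_le1 g : measurable_fun setT g -> risk Pi g <= 1.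
Proof.
move=> mg; apply: (le_has_mean (has_mean_err Pi mg) (has_mean_cst Pi 1)) => z.
by rewrite lern1 leq_b1.
Qed.

Lemma risk_ge0 g : 0 <= risk Pi g.
Proof. by rewrite fine_ge0. Qed.

Lemma measurable_sgn_aggregate M (f : 'I_M -> X -> bool) (w : 'I_M -> R) :
  (forall j, measurable_fun setT (f j)) ->
  measurable_fun setT (fun x => sgn (aggregate f w x)).
Proof.
move=> mf; apply: measurable_fun_ler => //; rewrite /aggregate.
apply: measurable_sum => j; apply: measurable_funM => //.
exact: (measurableT_comp (f := lab R)).
Qed.

(* Weighted majority: if the sign of the aggregate disagrees with the Bayes
   rule at [x], the rules disagreeing with it at [x] have weight at least 1/2. *)
Lemma excess_aggregate_le M (f : 'I_M -> X -> bool) (w : 'I_M -> R) :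
  (forall j, measurable_fun setT (f j)) ->
  (forall j, 0 <= w j) -> \sum_j w j = 1 ->
  risk_real Pi (aggregate f w) - risk Pi bay
    <= 2 * \sum_j w j * excess (f j).
Proof.
move=> mf w0 w1; pose maj x := sgn (aggregate f w x).
have mmaj : measurable_fun setT maj := measurable_sgn_aggregate w mf.
pose t x := ([ffun j => f j x != bay x], maj x != bay x).
(* Twice the dissenting weight minus the indicator that the majority dissents. Its mean against the
   product of the Bayes label and the true label is the right side minus the left side of the
   claim. *)
pose q (k : {ffun 'I_M -> bool} * bool) : R :=
  2 * (\sum_j w j * (k.1 j)%:R) - k.2%:R.
have mt : finitely_measurable t.
  apply: finitely_measurable_pair; last exact: finitely_measurable_neq_bayes.
  by apply: finitely_measurable_ffun => j; exact: finitely_measurable_neq_bayes.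
have q0 x : 0 <= q (t x).
  rewrite /q /=; under eq_bigr do rewrite ffunE.
  set e := \sum_j _.
  have e0 : 0 <= e by apply: sumr_ge0 => j _; rewrite mulr_ge0.
  (* Rules agreeing with the Bayes rule contribute their weight and the others its opposite, so the
     majority can dissent only if 2 e >= 1. *)
  have aggE : aggregate f w x = lab R (bay x) * (1 - 2 * e).
    have -> : 1 - 2 * e = \sum_j w j - 2 * e by rewrite w1.
    rewrite /aggregate /e mulr_sumr -sumrB mulr_sumr; apply: eq_bigr => j _.
    by case: (f j x); case: (bay x); rewrite /lab/=; lra.
  move: aggE; rewrite /maj /sgn => ->; case: (bay x); rewrite /lab ?mul1r ?mulN1r.
    by case: (leP 0 (1 - 2 * e)) => /= ?; lra.
  by case: (leP 0 (- (1 - 2 * e))) => /= ?; lra.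
have [v v0 vE] := bayes_weight_mean_ge0 mt q0.
rewrite -subr_ge0 (_ : _ - _ = v)//; apply: has_mean_unique vE.
have := has_meanB (has_meanZ 2 (has_mean_sum (fun j =>
  has_meanZ (w j) (has_mean_excess (mf j))))) (has_mean_excess mmaj).
apply: eq_has_mean => -[x y] /=.
rewrite /q /= mulrBr; congr (_ - _).
rewrite mulrCA; congr (_ * _); rewrite mulr_sumr; apply: eq_bigr => j _.
by rewrite ffunE mulrCA.
Qed.

(** For x >= 0, squaring exp(x/2) <= 1/(1 - x/2) leaves a polynomial inequality on [0, 1]; for x <
    0, exp x <= 1/(1 - x) suffices. *)
Lemma expR_le_quadratic (x : R) : `|x| <= 1 -> expR x <= 1 + x + 2 * x ^+ 2.
Proof.
have [x0 x1|x0] := leP 0 x.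
  have {}x1 : x <= 1 by rewrite (le_trans (ler_norm x)).
  have h : 1 - x / 2 <= expR (- (x / 2)) by have := expR_ge1Dx (- (x / 2)); lra.
  have e0 := expR_gt0 (x / 2).
  have : (1 - x / 2) * expR (x / 2) <= 1.
    by rewrite (le_trans (ler_wpM2r (ltW e0) h))// -expRD addNr expR0.
  have -> : expR x = expR (x / 2) * expR (x / 2).
    by rewrite -expRD; congr expR; lra.
  set y := expR (x / 2) in e0 * => hy.
  have h2 : (1 - x / 2) ^+ 2 * (y * y) <= 1.
    have -> : (1 - x / 2) ^+ 2 * (y * y) = ((1 - x / 2) * y) ^+ 2 by ring.
    by rewrite exprn_ile1// mulr_ge0 ?(ltW e0)//; lra.
  have h3 : 1 <= (1 - x / 2) ^+ 2 * (1 + x + 2 * x ^+ 2).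
    have : 0 <= x ^+ 2 * ((1 - x) * (5/4 - x/2)).
      by rewrite mulr_ge0 ?sqr_ge0// mulr_ge0; lra.
    have -> : (1 - x / 2) ^+ 2 * (1 + x + 2 * x ^+ 2) =
      1 + x ^+ 2 * ((1 - x) * (5/4 - x/2)) by field.
    by lra.
  have h4 : 0 < (1 - x / 2) ^+ 2 by rewrite exprn_gt0//; lra.
  by rewrite -(ler_pM2l h4) (le_trans h2).
move=> _; have h := expR_ge1Dx (- x); have e0 := expR_gt0 x.
have : (1 - x) * expR x <= 1.
  by rewrite (le_trans (ler_wpM2r (ltW e0) h))// -expRD addNr expR0.
move=> h2; have h3 : 1 <= (1 - x) * (1 + x + 2 * x ^+ 2) by nra.
by rewrite -(ler_pM2l (_ : 0 < 1 - x)) ?(le_trans h2)//; lra.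
Qed.

(** The exponent vanishes where [g] agrees with the Bayes rule and is [s] or [- s] elsewhere, so its
    square has mean s^2 v. The linear term has mean -s times the excess risk, and 1 + x <= exp x
    concludes. *)
Lemma excess_mgf g (s v : R) : measurable_fun setT g -> 0 <= s <= 1 ->
  has_mean Pi (fun z => (g z.1 != bay z.1)%:R) v ->
  exists2 m,
    has_mean Pi
      (fun z => expR (- (s * ((z.2 != g z.1)%:R - (z.2 != bay z.1)%:R)))) m &
    m <= expR (- (s * excess g) + 2 * s ^+ 2 * v).
Proof.
move=> mg s01 vE.
have mt := finitely_measurable_pair (finitely_measurable_err mg)
  (finitely_measurable_err (measurable_bayes heta)).
have mE := has_mean_fin Pi
  (fun k : bool * bool => expR (- (s * (k.1%:R - k.2%:R)))) mt.
eexists; first exact: mE.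
have E2 := has_meanD (has_meanD (has_mean_cst Pi 1) (has_meanN (has_meanZ s
  (has_mean_excess mg)))) (has_meanZ (2 * s ^+ 2) vE).
apply: le_trans (le_has_mean mE E2 _) _; last first.
  by rewrite -addrA; exact: expR_ge1Dx.
move=> -[x y] /=.
have h1 : `|s| <= 1 by rewrite ger0_norm; lra.
have h2 : `|- s| <= 1 by rewrite normrN.
move/expR_le_quadratic : h1; move/expR_le_quadratic : h2; rewrite sqrrN.
by case: (g x); case: (bay x); case: y => /=;
  rewrite /lab ?subrr ?subr0 ?sub0r ?mulr0 ?mulr1 ?mulrN1 ?opprK ?oppr0 ?expR0; lra.
Qed.

(** The integrand of the margin assumption is twice the indicator of disagreement, and [v] is also
    the second moment of the difference of losses. *)
Lemma margin_disagreement g (kappa c : R) :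
  margin_assumption Pi eta kappa c -> measurable_fun setT g ->
  exists2 v, has_mean Pi (fun z => (g z.1 != bay z.1)%:R) v &
    2 * v <= c * excess g `^ kappa^-1.
Proof.
move=> hMA mg; have mt := finitely_measurable_pre
  (@measurable_fst _ _ X bool) (finitely_measurable_neq_bayes mg).
have vE := has_mean_true Pi mt.
exists (fine (Pi [set z | g z.1 != bay z.1])) => //.
rewrite -lee_fin (le_trans _ (hMA g mg))// unlock.
rewrite -(has_meanZ 2 vE).2 le_eqVlt; apply/orP; left; apply/eqP.
apply: eq_integral => -[x y] _ /=; congr EFin.
case: (g x); case: (bay x); rewrite /lab/= ?mulr1 ?mulr0 ?subrr ?normr0//.
  by rewrite opprK ger0_norm.
by rewrite -opprD normrN ger0_norm.
Qed.

End ExcessRisk.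

(** * Oracle inequality *)

Section FiniteMin.
Context (R : realType).

Lemma minI_attained M (F : 'I_M -> R) : (0 < M)%N ->
  exists2 j0, minI F = F j0 & forall j, F j0 <= F j.
Proof.
case: M F => // M F _.
have [j0 _ j0min] := @arg_minP _ R _ ord0 xpredT F isT.
have F0 j : F j0 <= F j by exact: j0min.
exists j0 => //; apply/eqP; rewrite eq_le; apply/andP; split.
  by apply: ge_inf; [exists (F j0) => _ [j _ <-]|exists j0].
by apply: lb_le_inf; [exists (F j0), j0|move=> _ [j _ <-]].
Qed.

Lemma minI_le M (F : 'I_M -> R) j : minI F <= F j.
Proof.
have M0 : (0 < M)%N by case: M F j => // F [].
by have [j0 ->] := minI_attained F M0.
Qed.

End FiniteMin.

(** * Empirical risks of rules and of their convex combinations *)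

Section EmpiricalRisk.
Context (R : realType) (X : Type) (n : nat) (D : 'I_n -> (X * bool)%type).
Implicit Types g : X -> bool.

Definition emp_error g : R := n%:R^-1 * \sum_(i < n) ((D i).2 != g (D i).1)%:R.

Lemma hinge_risk_rule g : hinge_risk D (rule_fun R g) = 2 * emp_error g.
Proof.
rewrite /hinge_risk /emp_error mulrCA [2 * _]mulr_sumr; congr (_ * _).
apply: eq_bigr => i _; rewrite /rule_fun.
case: (D i) => x y /=; case: y; case: (g x) => /=; rewrite /lab.
- by rewrite mulr1 subrr maxxx mulr0.
- by rewrite mul1r opprK mulr1 max_r.
- by rewrite mulr1 opprK mulr1 max_r.
- by rewrite mulrNN mulr1 subrr maxxx mulr0.
Qed.

Lemma emp_risk_rule g : emp_risk D (rule_fun R g) = emp_error g.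
Proof.
rewrite /emp_risk /emp_error; congr (_ * _); apply: eq_bigr => i _.
rewrite /rule_fun; case: (D i) => x y /=; congr (nat_of_bool _)%:R.
case: y; case: (g x) => /=; rewrite /lab ?mulrNN ?mul1r ?mulr1 ?lerN10 ?oppr_le0//.
all: by rewrite ?ler10 ?ler01.
Qed.

(** Rules take values in {-1, 1}, so 1 - y h is nonnegative for each rule and each convex
    combination: the positive part never acts. *)
Lemma hinge_risk_aggregate M (f : 'I_M -> X -> bool) (w : 'I_M -> R) :
  (forall j, 0 <= w j) -> \sum_j w j = 1 ->
  hinge_risk D (aggregate f w) = \sum_j w j * hinge_risk D (rule_fun R (f j)).
Proof.
move=> w0 w1; under [RHS]eq_bigr do rewrite mulrCA mulr_sumr.
rewrite -mulr_sumr /hinge_risk exchange_big/=; congr (_ * _).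
apply: eq_bigr => i _.
have labM j : 0 <= 1 - lab R (D i).2 * rule_fun R (f j) (D i).1.
  rewrite /rule_fun; case: (D i) => x y /=.
  by case: y; case: (f j x); rewrite /lab; lra.
under [RHS]eq_bigr do rewrite max_r//.
have E : 1 - lab R (D i).2 * aggregate f w (D i).1 =
    \sum_j w j * (1 - lab R (D i).2 * rule_fun R (f j) (D i).1).
  rewrite -[in LHS]w1; rewrite /aggregate mulr_sumr -sumrB.
  by apply: eq_bigr => j _; rewrite /rule_fun mulrBr mulr1 mulrCA.
by rewrite E max_r// sumr_ge0// => j _; rewrite mulr_ge0.
Qed.

(* The maximum of the exponents is bounded by x <= l + exp (x - l) - 1, a
   linearized Jensen inequality, so that only the mean of the sum of the
   exponentials is needed. *)
Lemma aggregate_oracle_pointwise M (f : 'I_M -> X -> bool) (w u : 'I_M -> R)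
    (g : X -> bool) (j0 : 'I_M) (s gam l : R) :
  (0 < n)%N -> 0 < s ->
  (forall j, 0 <= w j) -> \sum_j w j = 1 ->
  hinge_risk D (aggregate f w) <=
    minI (fun j => hinge_risk D (rule_fun R (f j))) + ln M%:R / n%:R ->
  (1 - gam) * (2 * \sum_j w j * u j) <=
    2 / (s * n%:R) *
      (l + (\sum_j expR (s * n%:R * (1 - gam) * u j) *
          \prod_i expR (- (s * (((D i).2 != f j (D i).1)%:R
                                - ((D i).2 != g (D i).1)%:R)))) * expR (- l) - 1)
    + 2 * (emp_error (f j0) - emp_error g) + ln M%:R / n%:R.
Proof.
move=> n0 s0 w0 w1 hw.
have nR0 : 0 < n%:R :> R by rewrite ltr0n.
have sn0 : 0 < s * n%:R by rewrite mulr_gt0.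
set S := (\sum_j _ * \prod_i _); set T := (l + _ - 1).
(* Scaled so that [expR (x j)] is exactly the j-th term of [S]. *)
pose x j := s * n%:R * ((1 - gam) * u j - (emp_error (f j) - emp_error g)).
have SE : S = \sum_j expR (x j).
  apply: eq_bigr => j _; rewrite -expR_sum -expRD; congr expR.
  rewrite /x /emp_error sumrN -mulr_sumr sumrB.
  set A := \sum_i _; set B := \sum_i _.
  by field; rewrite gt_eqF.
have xT j : x j <= T.
  have h := expR_ge1Dx (x j - l).
  have : expR (x j) <= S.
    by rewrite SE (bigD1 j)//= lerDl sumr_ge0// => k _; rewrite expR_ge0.
  move/(ler_wpM2r (expR_ge0 (- l))); rewrite -expRD.
  by rewrite /T; lra.
have wx : \sum_j w j * ((1 - gam) * u j - (emp_error (f j) - emp_error g))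
    <= T / (s * n%:R).
  have -> : T = \sum_j w j * T by rewrite -mulr_suml w1 mul1r.
  rewrite ler_pdivlMr// mulr_suml.
  apply: ler_sum => j _; rewrite -mulrA ler_wpM2l//.
  by rewrite mulrC; exact: xT.
(* The hinge risk of a rule is twice its empirical error, hence the halved logarithmic term. *)
have hj0 : \sum_j w j * emp_error (f j) <= emp_error (f j0) + ln M%:R / n%:R / 2.
  have := le_trans hw (lerD (minI_le _ j0) (lexx _)).
  rewrite hinge_risk_aggregate// hinge_risk_rule.
  under eq_bigr do rewrite hinge_risk_rule mulrCA.
  by rewrite -mulr_sumr; lra.
have E : \sum_j w j * ((1 - gam) * u j - (emp_error (f j) - emp_error g)) =
   (1 - gam) * \sum_j w j * u j - \sum_j w j * emp_error (f j) + emp_error g.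
  have egE : emp_error g = \sum_j w j * emp_error g.
    by rewrite -mulr_suml w1 mul1r.
  rewrite [X in _ = _ + X]egE.
  rewrite mulr_sumr -sumrB -big_split/=.
  by apply: eq_bigr => j _; ring.
rewrite mulrAC -[2 * T / _]mulrA.
by move: wx; rewrite E; lra.
Qed.

End EmpiricalRisk.

Section OracleInequality.
Context (R : realType) (d d' : measure_display).
Context (X : measurableType d) (Omega : measurableType d').
Variables (P : probability Omega R) (Pi : probability (X * bool)%type R).
Variables (eta : X -> R) (n M : nat) (Z : 'I_n -> Omega -> (X * bool)%type).
Variable f : 'I_M -> X -> bool.
Hypothesis heta : is_regression Pi eta.
Hypothesis hZ : iid_sample Z P Pi.
Hypothesis hf : forall j, measurable_fun setT (f j).
Local Notation bay := (bayes eta).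
Local Notation excess g := (risk Pi g - risk Pi bay).

Lemma has_mean_emp_error g : (0 < n)%N -> measurable_fun setT g ->
  has_mean P (fun om => emp_error R (Z^~ om) g) (risk Pi g).
Proof.
move=> n0 mg; have merr := finitely_measurable_err mg.
have gE : has_mean Pi ((fun b : bool => b%:R) \o (fun z => z.2 != g z.1))
  (risk Pi g) := has_mean_err Pi mg.
have := has_meanZ n%:R^-1 (has_mean_sum (fun i => has_mean_sample hZ merr gE i)).
by rewrite sumr_const card_ord -[X in _^-1 * X]mulr_natl mulKf// pnatr_eq0 -lt0n.
Qed.

Lemma excess_aggregate_bounds (w : 'I_M -> Omega -> R) om :
  admissible_weights Z f w ->
  0 <= risk_real Pi (aggregate f (w^~ om)) - risk Pi bay <=
    2 * \sum_j w j om * excess (f j).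
Proof.
case=> _ w0 w1 _; apply/andP; split.
  by apply: excess_ge0 => //; exact: measurable_sgn_aggregate.
exact: excess_aggregate_le.
Qed.

(** The pointwise bound is integrated. The hypothesis on [v] trades the second-order term for a
    fraction [gam] of the excess risk plus [tau]; the factor (1 - gam) in the exponent then cancels
    what remains of the excess risk. *)
Lemma expected_excess_oracle (w : 'I_M -> Omega -> R) (j0 : 'I_M)
    (s gam tau : R) :
  (0 < n)%N -> (0 < M)%N -> 0 < s <= 1 -> 0 < gam < 1 ->
  (forall j, exists2 v,
     has_mean Pi (fun z => (f j z.1 != bay z.1)%:R) v &
     2 * s ^+ 2 * v <= s * gam * excess (f j) + tau) ->
  admissible_weights Z f w ->
  ('E_P[fun om => (risk_real Pi (aggregate f (w^~ om)) - risk Pi bay)%R] <=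
   ((1 - gam)^-1 * (2 * excess (f j0)
      + 2 / (s * n%:R) * (ln M%:R + n%:R * tau) + ln M%:R / n%:R))%:E)%E.
Proof.
move=> n0 M0 s01 gam01 hv hw.
have nR0 : 0 < n%:R :> R by rewrite ltr0n.
have MR0 : 0 < M%:R :> R by rewrite ltr0n.
have mbay := measurable_bayes heta.
(* Each of the M exponential moments is at most exp(n tau), so [l] is the logarithm of the bound on
   their sum, and the bracket of the pointwise bound has mean at most [l]. *)
pose l := ln M%:R + n%:R * tau.
pose a j := expR (s * n%:R * (1 - gam) * excess (f j)).
pose F j z := expR (- (s * ((z.2 != f j z.1)%:R - (z.2 != bay z.1)%:R))) : R.
have /choice[m mP] : forall j, exists m, has_mean Pi (F j) m /\
    m <= expR (s * (gam - 1) * excess (f j) + tau).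
  move=> j; have [v vE hvj] := hv j.
  have [|m mE mle] := @excess_mgf _ _ _ _ _ heta _ s _ (hf j) _ vE; first lra.
  exists m; split=> //; apply: le_trans mle _; rewrite ler_expR; lra.
have prodE j : has_mean P (fun om => \prod_i F j (Z i om)) (m j ^+ n).
  have mt := finitely_measurable_pair (finitely_measurable_err (hf j))
    (finitely_measurable_err mbay).
  exact: (has_mean_prod_sample hZ
    (g := fun k : bool * bool => expR (- (s * (k.1%:R - k.2%:R)))) mt (mP j).1).
have m0 j : 0 <= m j.
  by apply: (le_has_mean (has_mean_cst Pi 0) (mP j).1) => z; exact: expR_ge0.
pose mS := \sum_j a j * m j ^+ n.
have SE : has_mean P (fun om => \sum_j a j * \prod_i F j (Z i om)) mS.
  by apply: has_mean_sum => j; exact: has_meanZ.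
have mSl : mS <= expR l.
  have -> : expR l = \sum_(j < M) expR (n%:R * tau).
    by rewrite sumr_const card_ord /l expRD lnK// mulr_natl.
  apply: ler_sum => j _.
  apply: le_trans (ler_wpM2l (expR_ge0 _) (lerXn2r n (m0 j) (expR_ge0 _) (mP j).2)) _.
  by rewrite -expRM_natl -expRD ler_expR -mulr_natl; lra.
have UE := has_meanZ (1 - gam)^-1 (has_meanD (has_meanD
  (has_meanZ (2 / (s * n%:R)) (has_meanB (has_meanD (has_mean_cst P l)
     (has_meanZ (expR (- l)) SE)) (has_mean_cst P 1)))
  (has_meanZ 2 (has_meanB (has_mean_emp_error n0 (hf j0))
                          (has_mean_emp_error n0 mbay))))
  (has_mean_cst P (ln M%:R / n%:R))).
apply: le_trans (expectation_le_mean UE _) _.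
  move=> om; have /andP[-> /= /le_trans->//] := excess_aggregate_bounds om hw.
  have [_ w0 w1 wh] := hw.
  rewrite /= ler_pdivlMl; last lra.
  have s0 : 0 < s by lra.
  have := aggregate_oracle_pointwise (fun j => excess (f j)) bay j0 gam l
    n0 s0 (w0^~ om) (w1 om) (wh om).
  by rewrite [expR (- l) * _]mulrC.
have gi0 : 0 <= (1 - gam)^-1 by rewrite invr_ge0; lra.
rewrite lee_fin ler_wpM2l//.
have hS : expR (- l) * mS <= 1.
  by rewrite (le_trans (ler_wpM2l (expR_ge0 _) mSl))// -expRD addNr expR0.
have hT : 2 / (s * n%:R) * (l + expR (- l) * mS - 1) <= 2 / (s * n%:R) * l.
  by rewrite ler_wpM2l ?divr_ge0 ?mulr_ge0//; lra.
by rewrite -/l; lra.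
Qed.

End OracleInequality.

(** * Rates *)

Section Rates.
Context (R : realType).
Implicit Types a b c kappa x y u : R.

(** Both bases are at most m = max(u, y) and the exponents add up to 1. *)
Lemma powR_interpolation y u (p : R) : 0 < y -> 0 <= u -> 0 <= p <= 1 ->
  y `^ (1 - p) * u `^ p <= u + y.
Proof.
move=> y0 u0 p01; set m := Num.max u y.
have ym : y <= m by rewrite le_max lexx orbT.
have um : u <= m by rewrite le_max lexx.
have m0 : 0 < m := lt_le_trans y0 ym.
have : y `^ (1 - p) * u `^ p <= m `^ (1 - p) * m `^ p.
  by rewrite ler_pM ?powR_ge0// ge0_ler_powR ?nnegrE ?(ltW m0) ?(ltW y0)//; lra.
have mN0 : m != 0 by rewrite gt_eqF.
rewrite -powRD ?mN0 ?implybT// subrK powRr1 ?(ltW m0)// => /le_trans; apply.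
by rewrite ge_max; apply/andP; split; lra.
Qed.

(** Tenth power of exp(-1/10) >= 9/10. It serves to deduce M <= 2 from ln M < 1. *)
Lemma expR1_le3 : expR 1 <= 3 :> R.
Proof.
have h : 9 / 10 <= expR (- (1 / 10)) :> R.
  by have := expR_ge1Dx (- (1 / 10) : R); lra.
have : (9 / 10) ^+ 10 <= expR (- (1 / 10)) ^+ 10 :> R.
  by rewrite lerXn2r ?nnegrE ?expR_ge0//; lra.
rewrite -expRM_natl (_ : 10%:R * _ = -1 :> R); last by lra.
have e0 := expR_gt0 (1 : R); move/(ler_wpM2r (ltW e0)).
rewrite -expRD addNr expR0 => h2.
have : (1/3 : R) <= (9/10) ^+ 10 by lra.
by move/(ler_wpM2r (ltW e0)); lra.
Qed.

Lemma ln2_ge : 3 / 5 <= ln 2 :> R.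
Proof.
rewrite -ler_expR lnK ?posrE//.
have h : 9 / 10 <= expR (- (1 / 10)) :> R.
  by have := expR_ge1Dx (- (1 / 10) : R); lra.
have : (9 / 10) ^+ 6 <= expR (- (1 / 10)) ^+ 6 :> R.
  by rewrite lerXn2r ?nnegrE ?expR_ge0//; lra.
rewrite -expRM_natl (_ : 6%:R * _ = - (3 / 5) :> R); last by lra.
have e0 := expR_gt0 (3 / 5 : R); move/(ler_wpM2r (ltW e0)).
rewrite -expRD addNr expR0 => h2.
have : (1/2 : R) <= (9/10) ^+ 6 by lra.
by move/(ler_wpM2r (ltW e0)); lra.
Qed.

Lemma rate_exponent kappa : 1 <= kappa -> 0 <= kappa / (2 * kappa - 1) <= 1.
Proof.
move=> k1; have h : 0 < 2 * kappa - 1 by lra.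
apply/andP; split; first by apply: divr_ge0; lra.
by rewrite ler_pdivrMr//; lra.
Qed.

Lemma rate_ge1 kappa x : 1 <= kappa -> 1 <= x ->
  1 <= x `^ (kappa / (2 * kappa - 1)) <= x.
Proof.
move=> /rate_exponent/andP[h0 h1] x1.
by rewrite ler1_powR// -[leLHS](powRr0 x) ler_powR.
Qed.

(** The balance that fixes the rate: for p = kappa/(2 kappa - 1), one has 1 - p (1 - 1/kappa) =
    p. *)
Lemma rate_split kappa x : 1 <= kappa -> 1 <= x ->
  (x `^ (kappa / (2 * kappa - 1)))^-1 `^ (1 - kappa^-1) * x =
  x `^ (kappa / (2 * kappa - 1)).
Proof.
move=> k1 x1; have x0 : 0 < x := lt_le_trans ltr01 x1.
have xN0 : x != 0 by rewrite gt_eqF.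
rewrite -powRN -powRrM -[X in _ * X]powRr1 ?ltW// -powRD ?xN0 ?implybT//.
by congr powR; field; lra.
Qed.

Lemma C0_ge10 a b c : 0 < c -> 10 <= C0 a b c.
Proof.
move=> c0; rewrite /C0 -addrA lerDl addr_ge0// mulr_ge0 ?powR_ge0 ?expR_ge0//.
exact: ltW.
Qed.

Lemma C0_ge_expR a b c : 0 < c -> 
  a `^ (- (1 / b)) * expR (Num.max (b * (8 * c / 6) ^+ 2)
    ((Num.max (8 * c / 3) 1 / b) ^+ 2)) <= C0 a b c.
Proof.
move=> c0; rewrite /C0 lerDr addr_ge0// mulr_ge0 ?powR_ge0 ?expR_ge0//.
exact: ltW.
Qed.

(* The last term of [C0] dominates the sample size as long as [ln M] is below
   the threshold; above it, [c] is small compared with [sqrt (ln M)]. *)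
Lemma C0_dichotomy a b c kappa (n M : nat) :
  1 <= a -> 0 < b -> 0 < c -> 1 <= kappa -> (1 <= n)%N -> (2 <= M)%N ->
  a * n%:R `^ b <= M%:R ->
  n%:R `^ (kappa / (2 * kappa - 1)) <= C0 a b c :> R \/
  (1 <= ln M%:R :> R) /\ (2 * c) ^+ 2 <= ln M%:R.
Proof.
move=> a1 b0 c0 k1 n1 M2 hMn; set N := _ `^ _; set L := ln _.
have nR1 : 1 <= n%:R :> R by rewrite ler1n.
have MR0 : 0 < M%:R :> R by rewrite ltr0n (leq_trans _ M2).
have a0 : 0 < a by lra.
have /andP[_ Nn] := rate_ge1 k1 nR1.
have nM : n%:R <= a `^ (- (1 / b)) * expR (L / b).
  have nb : n%:R `^ b <= a^-1 * M%:R by rewrite -ler_pdivrMl ?invr_gt0// invrK.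
  have -> : n%:R = (n%:R `^ b) `^ (1 / b) :> R.
    by rewrite -powRrM mulrCA mulfV ?gt_eqF// mulr1 powRr1.
  have -> : a `^ (- (1 / b)) * expR (L / b) = (a^-1 * M%:R) `^ (1 / b).
    rewrite powRM ?invr_ge0 ?ltW// powRN -(powR_inv1 (ltW a0)) -powRrM mulN1r powRN.
    by rewrite [M%:R `^ _]/powR gt_eqF// mul1r [_ / b]mulrC.
  apply: ge0_ler_powR; rewrite ?nnegrE ?powR_ge0//.
    by rewrite divr_ge0 // ltW.
  by rewrite mulr_ge0 ?invr_ge0 // ltW.
set K := Num.max (b * (8 * c / 6) ^+ 2) ((Num.max (8 * c / 3) 1 / b) ^+ 2).
have [LK|KL] := leP (L / b) K.
  left; apply: le_trans Nn (le_trans nM (le_trans _ (C0_ge_expR a b c0))).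
  by rewrite ler_wpM2l ?powR_ge0// ler_expR.
move: KL; rewrite /K gt_max => /andP[K1 K2].
set m := Num.max (8 * c / 3) 1 in K2.
have m1 : 1 <= m by rewrite le_max lexx orbT.
have mc : 8 * c / 3 <= m by rewrite le_max lexx.
have {}K1 : b ^+ 2 * (8 * c / 6) ^+ 2 < L.
  by move: K1; rewrite ltr_pdivlMr// mulrC mulrA -expr2.
have {}K2 : m ^+ 2 < b * L.
  move: K2; rewrite expr_div_n ltr_pdivrMr ?exprn_gt0//.
  by rewrite [b ^+ 2]expr2 mulrA divfK ?gt_eqF// mulrC.
have [L1|L1] := leP 1 L.
  (* If L < (2c)^2, the first threshold forces b < 3/2 and the second b > 16/9, a contradiction. *)
  right; split=> //; rewrite leNgt; apply/negP => cL.
  have c2 : 0 < c ^+ 2 by rewrite exprn_gt0.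
  have b1 : b ^+ 2 < 9 / 4.
    rewrite -(ltr_pM2r c2); have := lt_trans K1 cL.
    by rewrite !expr_div_n !exprMn; lra.
  have : (8 / 3) ^+ 2 * c ^+ 2 < b * 4 * c ^+ 2.
    have h : (8 * c / 3) ^+ 2 <= m ^+ 2 by rewrite lerXn2r ?nnegrE//; lra.
    have := ltr_pM2l b0 L ((2 * c) ^+ 2); rewrite cL.
    by move: h; rewrite !expr_div_n !exprMn; lra.
  by rewrite (ltr_pM2r c2); nra.
(* Here L < 1, so M = 2, and b > 1 gives n <= n^b <= M <= 2, below the constant 10. *)
left; have b1 : 1 < b by nra.
have M3 : (M <= 2)%N.
  rewrite leqNgt; apply/negP => M3; move: L1; apply/negP; rewrite -leNgt.
  by rewrite -ler_expR lnK ?posrE// (le_trans expR1_le3)// ler_nat.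
have n2 : n%:R <= 2 :> R.
  apply: (le_trans (le1r_powR nR1 (ltW b1))).
  have M2' : M%:R <= 2 :> R by rewrite ler_nat.
  have := powR_ge0 (n%:R : R) b; nra.
by apply: le_trans Nn (le_trans n2 (le_trans _ (C0_ge10 a b c0))); lra.
Qed.

End Rates.

(** * Exponential weights and empirical risk minimization *)

Section Procedures.
Context (R : realType) (d d' : measure_display).
Context (X : measurableType d) (Omega : measurableType d').
Variables (n M : nat) (Z : 'I_n -> Omega -> (X * bool)%type).
Variable f : 'I_M -> X -> bool.
Hypothesis hf : forall j, measurable_fun setT (f j).

Let sample_sets := \big[setU/set0]_(i < n)
  preimage_set_system [set: Omega] (Z i) (@measurable _ (X * bool)%type).

Lemma sample_measurable_fin (K : finType) (t : Omega -> K) (h : K -> R) :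
  finitely_measurable (T := g_sigma_algebraType sample_sets) t ->
  sample_measurable Z (h \o t).
Proof.
move=> mt B _; have := finitely_measurable_post (fun k => `[< B (h k) >]) mt true.
rewrite (_ : _ @^-1` [set true] = (h \o t) @^-1` B)//.
by apply/seteqP; split=> om /= => [/asboolP|/asboolP].
Qed.

Lemma finitely_measurable_sample (K : finType) (e : X * bool -> K) :
  finitely_measurable e ->
  finitely_measurable (T := g_sigma_algebraType sample_sets)
    (fun om => [ffun i => e (Z i om)]).
Proof.
move=> me; apply: finitely_measurable_ffun => i.
apply: (finitely_measurable_pre (T := g_sigma_algebraType sample_sets)) me.
move=> _ A mA; apply: sub_sigma_algebra.
by rewrite /sample_sets (bigD1 i)//=; left; exists A.
Qed.

(** An entropy-free proof: with [y j] the gap x_k + ln M - x_j, the inequality exp(y)(1 - y) <= 1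
    gives a lower bound for each term exp(-x_j) y_j, and these bounds sum to S - exp(-x_k) >= 0. *)
Lemma gibbs_mean_le (x : 'I_M -> R) (k : 'I_M) :
  \sum_j expR (- x j) / (\sum_i expR (- x i)) * x j <= x k + ln M%:R.
Proof.
pose S := \sum_i expR (- x i); rewrite -/S.
have M0 : (0 < M)%N by apply: leq_ltn_trans (ltn_ord k).
have MR0 : 0 < M%:R :> R by rewrite ltr0n.
have kS : expR (- x k) <= S.
  by rewrite /S (bigD1 k)//= lerDl sumr_ge0// => j _; exact: expR_ge0.
have S0 : 0 < S := lt_le_trans (expR_gt0 _) kS.
pose y j := x k + ln M%:R - x j.
have ey j : expR (- x j) = expR (- x k) / M%:R * expR (y j).
  rewrite -[X in _ / X](lnK (x := M%:R)) ?posrE// -expRN -!expRD.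
  by congr expR; rewrite /y; lra.
have hy j : expR (- x j) - expR (- x k) / M%:R <= expR (- x j) * y j.
  have h := ler_wpM2l (expR_ge0 (y j)) (expR_ge1Dx (- y j)).
  have c0 : 0 <= expR (- x k) / M%:R by rewrite divr_ge0 ?expR_ge0 ?ltW.
  move: h; rewrite ey -expRD subrr expR0; move: (_ / _) c0 => C c0 h.
  by have := ler_wpM2l c0 h; lra.
have : 0 <= \sum_j expR (- x j) * y j.
  apply: le_trans (ler_sum _ (fun j _ => hy j)).
  rewrite sumrB sumr_const card_ord -[X in _ - X]mulr_natr divfK ?gt_eqF//.
  by rewrite subr_ge0.
rewrite /y; under eq_bigr do rewrite mulrBr.
rewrite sumrB -mulr_suml -/S subr_ge0 => h.
have -> : \sum_j expR (- x j) / S * x j = (\sum_j expR (- x j) * x j) / S.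
  by rewrite mulr_suml; apply: eq_bigr => j _; rewrite mulrAC.
by rewrite ler_pdivrMr// mulrC.
Qed.

Lemma admissible_aew : (0 < n)%N -> (0 < M)%N ->
  admissible_weights Z f (aew_weight R Z f).
Proof.
move=> n0 M0; have nR0 : 0 < n%:R :> R by rewrite ltr0n.
have S0 om : 0 < \sum_(k < M) expR (- (n%:R *
    hinge_risk (Z^~ om) (rule_fun R (f k)))).
  rewrite (bigD1 (Ordinal M0))//= ltr_pwDl ?expR_gt0//.
  by rewrite sumr_ge0// => k _; exact: expR_ge0.
have w0 j om : 0 <= aew_weight R Z f j om.
  by rewrite /aew_weight divr_ge0 ?expR_ge0// ltW.
have w1 om : \sum_j aew_weight R Z f j om = 1.
  by rewrite /aew_weight -mulr_suml divff// gt_eqF.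
split=> //.
(* The weights depend on the sample only through the finite table of errors of all the rules. *)
- move=> j; pose e (z : X * bool) := [ffun k => z.2 != f k z.1].
  have me : finitely_measurable e.
    by apply: finitely_measurable_ffun => k; exact: finitely_measurable_err.
  pose A (phi : {ffun 'I_n -> {ffun 'I_M -> bool}}) k : R :=
    2 * (n%:R^-1 * \sum_(i < n) (phi i k)%:R).
  have := sample_measurable_fin (fun phi => expR (- (n%:R * A phi j)) /
    \sum_(k < M) expR (- (n%:R * A phi k))) (finitely_measurable_sample me).
  have AE om k : A [ffun i => e (Z i om)] k =
      hinge_risk (Z^~ om) (rule_fun R (f k)).
    rewrite hinge_risk_rule /A /emp_error; congr (_ * (_ * _)).
    by apply: eq_bigr => i _; rewrite !ffunE.
  congr (sample_measurable Z _); rewrite /comp; apply/funext => om; rewrite /aew_weight AE.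
  by congr (_ / _); apply: eq_bigr => k _; rewrite AE.
- move=> om; rewrite hinge_risk_aggregate//.
  have [j0 -> _] := minI_attained
    (fun j => hinge_risk (Z^~ om) (rule_fun R (f j))) M0.
  have := gibbs_mean_le (fun j => n%:R * hinge_risk (Z^~ om) (rule_fun R (f j))) j0.
  rewrite /aew_weight; under eq_bigr do rewrite mulrCA.
  rewrite -mulr_sumr => h.
  by rewrite -(ler_pM2l nR0) mulrDr [n%:R * (ln _ / _)]mulrC divfK// gt_eqF.
Qed.

(** On rules the hinge risk is twice the empirical risk, so the selected rule also minimizes the
    hinge risk. *)
Lemma admissible_erm (jhat : Omega -> 'I_M) : (0 < n)%N -> (0 < M)%N ->
  is_erm R Z f jhat -> admissible_weights Z f (erm_weight R jhat).
Proof.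
move=> n0 M0 [mj ermj].
have w0 j om : 0 <= erm_weight R jhat j om by rewrite /erm_weight ler0n.
have sumE (F : 'I_M -> R) om : \sum_j erm_weight R jhat j om * F j = F (jhat om).
  rewrite (bigD1 (jhat om))//= /erm_weight eqxx mul1r big1 ?addr0// => j.
  by move=> /negPf ->; rewrite mul0r.
have w1 om : \sum_j erm_weight R jhat j om = 1.
  by rewrite -[RHS](sumE (fun=> 1) om); apply: eq_bigr => j _; rewrite mulr1.
split=> //.
- move=> j; exact: (sample_measurable_fin (fun k => (j == k)%:R) mj).
- move=> om; rewrite hinge_risk_aggregate// sumE.
  have [j0 -> _] := minI_attained
    (fun j => hinge_risk (Z^~ om) (rule_fun R (f j))) M0.
  rewrite !hinge_risk_rule -!emp_risk_rule.
  rewrite -[leLHS]addr0; apply: lerD; first by rewrite ler_pM2l//; exact: ermj.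
  by rewrite divr_ge0// ln_ge0// ler1n.
Qed.

End Procedures.

(** * Choice of the parameters *)

Lemma expected_excess_rate (R : realType) (d d' : measure_display)
    (X : measurableType d) (Omega : measurableType d')
    (P : probability Omega R) (Pi : probability (X * bool)%type R)
    (eta : X -> R) (kappa c : R) (n M : nat)
    (Z : 'I_n -> Omega -> (X * bool)%type)
    (f : 'I_M -> X -> bool) (w : 'I_M -> Omega -> R) (j0 : 'I_M) :
  is_regression Pi eta -> 1 <= kappa -> 0 < c ->
  margin_assumption Pi eta kappa c -> (1 <= n)%N -> (2 <= M)%N ->
  iid_sample Z P Pi -> (forall j, measurable_fun setT (f j)) ->
  admissible_weights Z f w ->
  1 <= ln (M%:R : R) -> (2 * c) ^+ 2 <= ln (M%:R : R) ->
  ('E_P[fun om => (risk_real Pi (aggregate f (w^~ om))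
                     - risk Pi (bayes eta))%R] <=
    ((1 + 2 / (ln M%:R) `^ (1 / 4)) *
       (2 * (risk Pi (f j0) - risk Pi (bayes eta))
        + 10 * ((ln M%:R) `^ (7 / 4)
                / n%:R `^ (kappa / (2 * kappa - 1)))))%R%:E)%E.
Proof.
move=> heta k1 c0 hMA n1 M2 hZ hf hw L1 cL.
set L := ln _ in L1 cL *; set N := n%:R `^ _.
have nR1 : 1 <= n%:R :> R by rewrite ler1n.
have nR0 : 0 < n%:R :> R by rewrite ltr0n.
(* With this unit, L = lam^4 and L^(7/4) = lam^7, so the remaining estimates are polynomial in
   [lam]. *)
pose lam := L `^ (1 / 4).
have L0 : 0 < L := lt_le_trans ltr01 L1.
have lam1 : 1 <= lam by rewrite -[leLHS](powRr0 L) ler_powR//; lra.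
have lamX k : lam ^+ k = L `^ (k%:R / 4).
  by rewrite -powR_mulrn ?powR_ge0// -powRrM; congr powR; lra.
have LE : L = lam ^+ 4 by rewrite lamX divff// powRr1// ltW.
have -> : L `^ (7 / 4) = lam ^+ 7 by rewrite lamX.
rewrite -/lam.
have /andP[N1 Nn] := rate_ge1 k1 nR1.
have rhoE := rate_split k1 nR1; rewrite -/N in N1 Nn rhoE.
set rho := N^-1 `^ _ in rhoE.
have N0 : 0 < N := lt_le_trans ltr01 N1.
have lam0 : 0 < lam := lt_le_trans ltr01 lam1.
have rho0 : 0 < rho by rewrite powR_gt0// invr_gt0.
have rho1 : rho <= 1 by rewrite -(ler_pM2r nR0) rhoE mul1r.
have c2 : 2 * c <= lam ^+ 2.
  have : (2 * c) ^+ 2 <= (lam ^+ 2) ^+ 2 by rewrite -exprM -LE.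
  by rewrite ler_pXn2r ?nnegrE ?exprn_ge0 ?(ltW lam0)//; lra.
(* [rho] equals N/n. The product s gam is s lam^(-3) times lam^2/2, and lam^2/2 is precisely what
   dominates the margin constant [c]. *)
pose s := (lam ^+ 3)^-1 * rho; pose gam := (2 * lam)^-1.
have l30 : 0 < (lam ^+ 3)^-1 by rewrite invr_gt0 exprn_gt0.
have s0 : 0 < s by rewrite mulr_gt0.
have s1 : s <= 1.
  have l31 : (lam ^+ 3)^-1 <= 1 by rewrite invf_le1 ?exprn_gt0// exprn_ege1.
  by rewrite -[leRHS]mulr1; apply: ler_pM => //; exact: ltW.
have gam0 : 0 < gam by rewrite invr_gt0; lra.
have gam1 : gam <= 1 / 2.
  by have : lam^-1 <= 1; [rewrite invf_le1|rewrite /gam invfM; lra].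
have hv j : exists2 v,
    has_mean Pi (fun z => (f j z.1 != bayes eta z.1)%:R) v &
    2 * s ^+ 2 * v <=
      s * gam * (risk Pi (f j) - risk Pi (bayes eta)) + s * gam / N.
  have [v vE v2] := margin_disagreement heta hMA (hf j).
  exists v => //; have u0 := excess_ge0 heta (hf j).
  set u := risk Pi (f j) - _ in v2 u0 *.
  have ki : 0 <= kappa^-1 <= 1.
    by rewrite invr_ge0 invf_le1; lra.
  have Ni0 : 0 < N^-1 by rewrite invr_gt0.
  have hint := powR_interpolation Ni0 u0 ki; rewrite -/rho in hint.
  have sgE : s * gam = s * (lam ^+ 3)^-1 * (lam ^+ 2 / 2).
    by rewrite /gam; field; rewrite gt_eqF.
  rewrite -mulrDr sgE.
  have -> : 2 * s ^+ 2 * v = s * (lam ^+ 3)^-1 * (rho * (2 * v)).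
    by rewrite expr2 {2}/s; ring.
  rewrite -[leRHS]mulrA ler_pM2l; last by rewrite mulr_gt0.
  have h1 : rho * (2 * v) <= c * (rho * u `^ kappa^-1).
    by rewrite [leRHS]mulrCA ler_pM2l.
  apply: le_trans h1 _; apply: ler_pM => //; first exact: ltW.
    by rewrite mulr_ge0 ?powR_ge0// ltW.
  lra.
have := expected_excess_oracle heta hZ hf j0 n1 (leq_trans (leqnSn 1) M2)
  (s := s) (gam := gam) (tau := s * gam / N) _ _ hv hw.
move=> /(_ _ _)/le_trans; apply; [lra|lra|].
rewrite lee_fin -/L.
set u := risk Pi (f j0) - _.
have u0 : 0 <= u := excess_ge0 heta (hf j0).
have snE : s * n%:R = N / lam ^+ 3 by rewrite /s -mulrA rhoE mulrC.
have -> : 2 / (s * n%:R) * (L + n%:R * (s * gam / N)) =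
    (2 * lam ^+ 7 + 2 * gam) / N.
  have -> : n%:R * (s * gam / N) = gam / lam ^+ 3.
    rewrite mulrA mulrA [n%:R * s]mulrC snE; field.
    by rewrite !gt_eqF.
  rewrite snE LE; field.
  by rewrite !gt_eqF.
have hLn : L / n%:R <= lam ^+ 7 / N.
  apply: ler_pM; [exact: ltW|by rewrite invr_ge0 ltW| |].
    by rewrite LE ler_weXn2l.
  by rewrite lef_pV2 ?posrE.
have h7 : 1 <= lam ^+ 7 by rewrite exprn_ege1.
(* Since 2 gam <= 1 <= lam^7, the first quotient is at most 3 lam^7/N and the last at most lam^7/N:
   4 would do in place of 10. *)
have h10 : (2 * lam ^+ 7 + 2 * gam) / N + L / n%:R <= 10 * (lam ^+ 7 / N).
  rewrite -lerBrDr; apply: (@le_trans _ _ ((3 * lam ^+ 7) / N)).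
    by rewrite ler_pM2r ?invr_gt0//; lra.
  have : 0 <= lam ^+ 7 / N by rewrite divr_ge0// ltW//; lra.
  by move: hLn; rewrite -mulrA; lra.
(* For gam <= 1/2, (1 - gam)(1 + 4 gam) = 1 + gam (3 - 4 gam) >= 1. *)
have hgam : (1 - gam)^-1 <= 1 + 2 / lam.
  have -> : 2 / lam = 4 * gam by rewrite /gam; field; rewrite gt_eqF.
  by rewrite invf_ple ?posrE; [|lra|lra]; rewrite -[_^-1]mul1r ler_pdivrMr; [nra|lra].
apply: ler_pM.
- by rewrite invr_ge0; lra.
- rewrite -addrA addr_ge0//; first by rewrite mulr_ge0.
  rewrite addr_ge0// divr_ge0//; try exact: ltW.
  by rewrite addr_ge0// mulr_ge0// ltW//; lra.
- exact: hgam.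
- lra.
Qed.

(** * Conclusion: combining the two regimes *)

Unset Implicit Arguments.
Set Strict Implicit.
Set Printing Implicit Defensive.

Theorem theorem2p3 (R : realType) (d d' : measure_display)
    (X : measurableType d) (Omega : measurableType d')
    (P : probability Omega R) (Pi : probability (X * bool)%type R)
    (eta : X -> R) (heta : is_regression Pi eta)
    (kappa c : R) (hkappa : 1 <= kappa) (hc : 0 < c)
    (hMA : margin_assumption Pi eta kappa c)
    (n M : nat) (hn : (1 <= n)%N) (hM : (2 <= M)%N)
    (a b : R) (ha : 1 <= a) (hb : 0 < b) (hMn : a * n%:R `^ b <= M%:R)
    (Z : 'I_n -> Omega -> (X * bool)%type) (hZ : iid_sample Z P Pi)
    (f : 'I_M -> X -> bool) (hf : forall j, measurable_fun setT (f j)) :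
  [/\ forall w : 'I_M -> Omega -> R, admissible_weights Z f w ->
        ('E_P[fun omega => (risk_real Pi (aggregate f (w^~ omega))
                           - risk Pi (bayes eta))%R]
         <= ((1 + 2 / (ln M%:R) `^ (1 / 4)) *
             (2 * minI (fun j => risk Pi (f j) - risk Pi (bayes eta))
              + C0 a b c * ((ln M%:R) `^ (7 / 4)
                            / n%:R `^ (kappa / (2 * kappa - 1)))))%R%:E)%E,
      0 < C0 a b c,
      admissible_weights Z f (aew_weight R Z f) &
      forall jhat : Omega -> 'I_M, is_erm R Z f jhat ->
        admissible_weights Z f (erm_weight R jhat)].
Proof.
have M0 : (0 < M)%N := leq_trans (leqnSn 1) hM.
have C010 := C0_ge10 a b hc.
split; [|lra|exact: admissible_aew|by move=> jhat; exact: admissible_erm].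
move=> w hw; have [j0 -> _] := minI_attained
  (fun j => risk Pi (f j) - risk Pi (bayes eta)) M0.
have u0 := excess_ge0 heta (hf j0).
set L := ln _; set N := n%:R `^ _.
have nR1 : 1 <= n%:R :> R by rewrite ler1n.
have /andP[N1 _] := rate_ge1 hkappa nR1; rewrite -/N in N1.
have N0 : 0 < N := lt_le_trans ltr01 N1.
have L35 : 3 / 5 <= L.
  by rewrite (le_trans (ln2_ge R))// ler_ln ?posrE ?ltr0n// ler_nat.
have L0 : 0 < L by lra.
have lam0 : 0 < L `^ (1 / 4) by rewrite powR_gt0.
case: (C0_dichotomy ha hb hc hkappa hn hM hMn) => [NC|[L1 cL]]; last first.
  apply: (le_trans (expected_excess_rate j0 heta hkappa hc hMA hn hM hZ hf hw L1 cL)).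
  rewrite lee_fin -/L -/N ler_pM2l ?lerD2l; last first.
    by rewrite ltr_wpDr// divr_ge0// ltW.
  by rewrite ler_wpM2r// divr_ge0 ?powR_ge0.
(* When N <= C0, the excess risk is bounded by 1, and the right-hand side is shown to be at least
   1. *)
apply: (@le_trans _ _ 1%:E).
  apply: (expectation_le_mean (has_mean_cst P 1)) => om.
  have /andP[-> _] /= := excess_aggregate_bounds heta hf om hw.
  rewrite lerBlDr (le_trans (risk_le1 _ _))//; last by rewrite lerDl risk_ge0.
  exact: measurable_sgn_aggregate.
rewrite lee_fin; pose lam := L `^ (1 / 4); rewrite -/lam in lam0 *.
have lamX k : lam ^+ k = L `^ (k%:R / 4).
  by rewrite -powR_mulrn ?powR_ge0// -powRrM; congr powR; lra.
have LE : L = lam ^+ 4 by rewrite lamX divff// powRr1// ltW.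
have -> : L `^ (7 / 4) = lam ^+ 7 by rewrite lamX.
have hC : lam ^+ 7 <= C0 a b c * (lam ^+ 7 / N).
  by rewrite mulrCA ler_peMr ?exprn_ge0 ?(ltW lam0)// ler_pdivlMr// mul1r.
have h2 : 0 < 1 + 2 / lam by rewrite ltr_wpDr// divr_ge0// ltW.
apply: (@le_trans _ _ ((1 + 2 / lam) * lam ^+ 7)); last by rewrite ler_pM2l//; lra.
have -> : (1 + 2 / lam) * lam ^+ 7 = lam ^+ 7 + 2 * lam ^+ 6.
  by field; rewrite gt_eqF.
have [lam1|lam1] := leP 1 lam.
  have : 1 <= lam ^+ 7 by rewrite exprn_ege1.
  have : 0 <= lam ^+ 6 by rewrite exprn_ge0// ltW.
  lra.
(* For lam < 1, lam^7 + 2 lam^6 >= 3 lam^8 = 3 L^2 >= 27/25, using L >= ln 2 >= 3/5. *)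
have e6 : lam ^+ 8 <= lam ^+ 6 by rewrite ler_wiXn2l// ltW.
have e7 : lam ^+ 8 <= lam ^+ 7 by rewrite ler_wiXn2l// ltW.
have : (3 / 5) ^+ 2 <= lam ^+ 8.
  have -> : lam ^+ 8 = L ^+ 2 by rewrite LE -exprM.
  by rewrite lerXn2r ?nnegrE//; lra.
lra.
Qed.
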